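(* The domain $G_{E(3;3;1,1,1)}\subset\mathbb C^7$ is linearly convex.
   Context: A domain $D\subset\mathbb C^n$ is called linearly convex if its complement $\mathbb C^n\setminus D$ is a union of affine complex hyperplanes. For a linear subspace $E$ of $\mathcal M_{n\times n}(\mathbb C)$, $\mu_E(A)=1/\inf\{\|X\|: X\in E,\ \det(I-AX)=0\}$, with $\mu_E(A)=0$ if $I-AX$ is nonsingular for all $X\in E$ (operator norm). $E(3;3;1,1,1)$ is the space of $3\times 3$ diagonal matrices, and $G_{E(3;3;1,1,1)}=\{\pi(A): A\in\mathcal M_{3\times3}(\mathbb C),\ \mu_{E(3;3;1,1,1)}(A)<1\}$ where $$\pi(A)=\big(a_{11},\ a_{22},\ a_{11}a_{22}-a_{12}a_{21},\ a_{33},\ a_{11}a_{33}-a_{13}a_{31},\ a_{22}a_{33}-a_{23}a_{32},\ \det A\big).$$ *)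

(* Defs.v *)
From mathcomp Require Import all_boot all_order all_algebra.
From mathcomp Require Import complex.
From mathcomp Require Import all_classical all_reals all_analysis.

Set Implicit Arguments.
Unset Strict Implicit.
Unset Printing Implicit Defensive.
Import Order.TTheory GRing.Theory Num.Theory.
Import numFieldNormedType.Exports.
Local Open Scope classical_set_scope.
Local Open Scope complex_scope.
Local Open Scope ring_scope.

(* Used at K := R[i]: the generic numFieldType is what gives 'rV[K]_n its
   (sup-norm, hence Euclidean) topology, as R[i] itself carries none in the
   library. *)
Definition domain (K : numFieldType) (n : nat) (D : set 'rV[K]_n) : Prop :=
  [/\ D !=set0, open D & connected D].

Definition affine_hyperplane (R : realType) (n : nat) (H : set 'rV[R[i]]_n) :
    Prop :=
  exists c : 'rV[R[i]]_n, exists b : R[i],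
    c != 0 /\ H = [set x | \sum_(i < n) c 0 i * x 0 i = b].

Definition linearly_convex (R : realType) (n : nat) (D : set 'rV[R[i]]_n) :
    Prop :=
  exists2 F : set (set 'rV[R[i]]_n),
    (forall H, F H -> affine_hyperplane H) & ~` D = \bigcup_(H in F) H.

Definition enorm (R : realType) (n : nat) (v : 'cV[R[i]]_n) : R :=
  Num.sqrt (\sum_(i < n) Normc.normc (v i 0) ^+ 2).

Definition opnorm (R : realType) (n : nat) (X : 'M[R[i]]_n) : R :=
  sup [set enorm (X *m v) | v in [set v : 'cV[R[i]]_n | enorm v <= 1]].

Definition singularizers (R : realType) (n : nat) (E : {vspace 'M[R[i]]_n})
    (A : 'M[R[i]]_n) : set 'M[R[i]]_n :=
  [set X | X \in E /\ \det (1%:M - A *m X) = 0].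

Definition mu_E (R : realType) (n : nat) (E : {vspace 'M[R[i]]_n})
    (A : 'M[R[i]]_n) : R :=
  if pselect (singularizers E A !=set0) then
    (inf [set opnorm X | X in singularizers E A])^-1
  else 0.

(* diag_mx maps a row vector to the diagonal matrix with these entries. *)
Definition E3_3_111 (R : realType) : {vspace 'M[R[i]]_3} :=
  limg (linfun (@diag_mx R[i] 3)).

Lemma mem_E3_3_111 (R : realType) (X : 'M[R[i]]_3) :
  (X \in E3_3_111 R) = is_diag_mx X.
Proof.
apply/idP/idP => [/memv_imgP[d _ ->]|/diag_mxP[d ->]].
  by rewrite lfunE; exact: diag_mx_is_diag.
by rewrite -[diag_mx d](lfunE (@diag_mx R[i] 3)); exact/memv_img/memvf.
Qed.

(* Indices are shifted down by one: A 0 1 is a_{12}. *)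
Definition pi3 (R : realType) (A : 'M[R[i]]_3) : 'rV[R[i]]_7 :=
  \row_(k < 7) nth 0
    [:: A 0 0;
        A 1 1;
        A 0 0 * A 1 1 - A 0 1 * A 1 0;
        A 2 2;
        A 0 0 * A 2 2 - A 0 2 * A 2 0;
        A 1 1 * A 2 2 - A 1 2 * A 2 1;
        \det A] k.

Definition G_E3_3_111 (R : realType) : set 'rV[R[i]]_7 :=
  [set pi3 A | A in [set A | mu_E (E3_3_111 R) A < 1]].
Arguments G_E3_3_111 : clear implicits.

(* Main.v *)
Require Import Defs.
From mathcomp Require Import all_boot all_order all_algebra.
From mathcomp Require Import complex.
From mathcomp Require Import all_classical all_reals all_analysis.
From mathcomp Require Import ring lra.

Set Implicit Arguments.
Unset Strict Implicit.
Unset Printing Implicit Defensive.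
Import Order.TTheory GRing.Theory Num.Theory.
Import numFieldNormedType.Exports.
Local Open Scope classical_set_scope.
Local Open Scope complex_scope.
Local Open Scope ring_scope.

(* For x = pi(A) the polynomial P_x(z) = det(I - A diag(z)) is an affine
   function of x whose coefficients are the monomials of z. Since pi is onto C^7
   and diag(z) has operator norm max |z_i|, G is the set of all x such that P_x
   has no zero in the closed unit polydisc (mu < 1 is a bound on a slightly larger
   polydisc, which comes for free from the openness of this condition).
   If x is not in G, then P_x(z) = 0 for some z in the polydisc, and the
   hyperplane {y | P_y(z) = 0} contains x and misses G. *)

(** * The polynomial attached to a point, its weighted scaling and its nonvanishing set *)

Section Multiaffine.
Context {K : numFieldType}.
Implicit Types (x : 'rV[K]_7) (z : 'rV[K]_3) (D : set K).

Definition monomials z : 'rV[K]_7 :=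
  \row_(k < 7) nth 0
    [:: - z 0 0; - z 0 1; z 0 0 * z 0 1; - z 0 2; z 0 0 * z 0 2;
        z 0 1 * z 0 2; - (z 0 0 * z 0 1 * z 0 2)] k.

Definition multiaffine x z : K :=
  1 + \sum_(k < 7) monomials z 0 k * x 0 k.

Definition polydisc D : set 'rV[K]_3 := [set z | forall i, D (z 0 i)].

Definition nonvanishing D : set 'rV[K]_7 :=
  [set x | forall z, polydisc D z -> multiaffine x z != 0].

(** Total degrees in [z] of the entries of [monomials]. Scaling coefficients with these weights
    amounts to dilating [z], which serves both to change the radius of the polydisc and to contract
    the domain to the origin. *)
Definition degrees : seq nat := [:: 1; 1; 2; 1; 2; 2; 3]%N.

Definition weighted_scale x (s : K) : 'rV[K]_7 :=
  \row_(k < 7) (s ^+ nth 0 degrees k * x 0 k).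

Lemma multiaffine_scale x (s : K) z :
  multiaffine (weighted_scale x s) z = multiaffine x (s *: z).
Proof.
rewrite /multiaffine !big_ord_recl !big_ord0 !mxE /=.
by congr (1 + _); ring.
Qed.

(** Entries 0, 1 and 3 are the coordinates of [z] up to sign. This makes the normal vector of the
    hyperplane attached to a nonzero [z] nonzero. *)
Lemma monomials_eq0 z : monomials z = 0 -> z = 0.
Proof.
move=> /rowP h; apply/rowP => i; rewrite mxE.
have h0 := h 0; have h1 := h 1; have h2 := h (inord 3).
rewrite !mxE /= ?inordK //= in h0 h1 h2.
move: h0 h1 h2 => /eqP; rewrite oppr_eq0 => /eqP h0.
move=> /eqP; rewrite oppr_eq0 => /eqP h1 /eqP; rewrite oppr_eq0 => /eqP h2.
by case: i => -[|[|[|//]]] p; [rewrite -[RHS]h0|rewrite -[RHS]h1|rewrite -[RHS]h2];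
  congr (z _ _); apply: val_inj.
Qed.

Lemma multiaffine0 x : multiaffine x 0 = 1.
Proof.
rewrite /multiaffine big1 ?addr0 // => k _; rewrite mxE.
by case: k => -[|[|[|[|[|[|[|//]]]]]]] p /=;
  rewrite !mxE !(mulr0, mul0r, oppr0).
Qed.

Lemma weighted_scale0 x : weighted_scale x 0 = 0.
Proof.
apply/rowP => -[[|[|[|[|[|[|[|//]]]]]]] p]; rewrite !mxE /=.
all: by rewrite expr0n mul0r.
Qed.

Lemma weighted_scale1 x : weighted_scale x 1 = x.
Proof. by apply/rowP => k; rewrite mxE expr1n mul1r. Qed.

Lemma nonvanishing0 D : nonvanishing D 0.
Proof.
move=> z _; rewrite /multiaffine big1 ?addr0 ?oner_eq0 // => k _.
by rewrite [X in _ * X]mxE mulr0.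
Qed.

Lemma continuous_row (T : topologicalType) n (f : T -> 'rV[K]_n) :
  (forall k, continuous (fun t => f t 0 k)) -> continuous f.
Proof.
move=> fk t A [B tB BA]; apply: filterS (BA) _.
have : \forall t' \near t, forall k, B 0 k (f t' 0 k).
  by apply: filter_forall => k; exact: fk.
by apply: filterS => t' h i j; rewrite ord1.
Qed.

Lemma continuous_exprn d : continuous (fun s : K => s ^+ d).
Proof.
elim: d => [|d IHd]; first exact: cst_continuous.
rewrite (_ : (fun s : K => s ^+ d.+1) = id \* (fun s => s ^+ d)).
  by move=> s; apply: continuousM; [exact: cvg_id|exact: IHd].
by apply/funext => s; rewrite exprS.
Qed.

Lemma continuous_weighted_scale x : continuous (weighted_scale x).
Proof.
apply: continuous_row => k.
rewrite (_ : (fun s => _) =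
    (fun s => s ^+ nth 0%N degrees k) \* cst (x 0 k)).
  move=> s; apply: continuousM; first exact: continuous_exprn.
  exact: cst_continuous.
by apply/funext => s; rewrite mxE.
Qed.

Lemma continuous_multiaffine :
  continuous (fun xz : 'rV[K]_7 * 'rV[K]_3 => multiaffine xz.1 xz.2).
Proof.
have cz i : continuous (fun xz : 'rV[K]_7 * 'rV[K]_3 => xz.2 0 i).
  by move=> xz; apply: (@cvg_comp _ _ _ snd (fun z : 'rV[K]_3 => z 0 i));
    [exact: cvg_snd|exact: coord_continuous].
have cx k : continuous (fun xz : 'rV[K]_7 * 'rV[K]_3 => xz.1 0 k).
  by move=> xz; apply: (@cvg_comp _ _ _ fst (fun x : 'rV[K]_7 => x 0 k));
    [exact: cvg_fst|exact: coord_continuous].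
move=> xz; apply: cvgD; first exact: cvg_cst.
apply: cvg_big => [|k _]; first exact: add_continuous.
apply: cvgM; last exact: cx.
under eq_fun do rewrite mxE.
rewrite mxE.
by case: k => -[|[|[|[|[|[|[|//]]]]]]] p /=; repeat first
  [exact: cz | apply: cvgN | apply: cvgM].
Qed.

(* The complement of [nonvanishing D] is the projection of a closed set along
   the compact polydisc, hence closed. *)
Lemma open_nonvanishing D : compact D -> open (nonvanishing D).
Proof.
move=> cD; rewrite openE => x Nx.
have /compact_near_coveringP cP : compact (polydisc D).
  exact: (@rV_compact _ _ (fun=> D)).
apply: (cP _ (nbhs x) (fun y z => multiaffine y z != 0)) => z /Nx xz0.
have h : \forall y \near x & w \near z, multiaffine y w != 0.
  exact: (cvgr_neq0 _ (@continuous_multiaffine (x, z)) xz0).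
case: h => -[A B] [/= xA zB] AB; exists (B, A) => // -[w y] [Bw Ay].
exact: (AB (y, w)).
Qed.
End Multiaffine.

(** * Topology of [R[i]] and compactness of the closed unit disc *)

Section ComplexDisc.
Context {R : realType}.
Local Notation C := (R[i] : numFieldType).

Definition unit_disc : set C := [set z | Normc.normc z <= 1].

Lemma continuous_real_complex : continuous (fun t : R => t%:C : C).
Proof.
move=> t A /nbhs_ballP[e /= e0 eA]; apply/nbhs_ballP.
(* The radius of a ball in [R[i]] is itself a complex number; being positive, it is real. *)
have eE : e = (complex.Re e)%:C.
  by rewrite RRe_real // realE ltW.
exists (complex.Re e) => /=; first by move: e0; rewrite {1}eE ltcR.
move=> s /= ts; apply: eA; rewrite /ball /= eE -rmorphB /= normc_def /=.
by rewrite expr0n addr0 sqrtr_sqr ltcR.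
Qed.

Lemma continuous_complex_pair :
  continuous (fun p : R * R => p.1 +i* p.2 : C).
Proof.
pose re (p : R * R) : C := p.1%:C; pose im (p : R * R) : C := p.2%:C.
have -> : (fun p : R * R => p.1 +i* p.2 : C) = re + cst ('i : C) \* im.
  by apply/funext => p; rewrite [LHS]complexE.
move=> p; apply: (@continuousD C C).
  apply: (@cvg_comp _ _ _ fst (fun t : R => t%:C : C)); first exact: cvg_fst.
  exact: continuous_real_complex.
apply: (@continuousM C); first exact: cst_continuous.
apply: (@cvg_comp _ _ _ snd (fun t : R => t%:C : C)); first exact: cvg_snd.
exact: continuous_real_complex.
Qed.

(** The disc is the continuous image of the real disc [S], a closed subset of the square with sides
    [[-1, 1]]. *)
Lemma compact_unit_disc : compact unit_disc.
Proof.
pose S : set (R * R) := [set p | p.1 ^+ 2 + p.2 ^+ 2 <= 1].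
have -> : unit_disc = (fun p : R * R => p.1 +i* p.2 : C) @` S.
  apply/seteqP; split => [[a b] /= ab|_ [[a b] /= ab <-]]; last first.
    by rewrite /unit_disc /= -(sqrtr1 R) ler_sqrt.
  by exists (a, b) => //=; rewrite /S /= -ler_sqrt ?sqrtr1.
apply: continuous_compact.
  exact/continuous_subspaceT/continuous_complex_pair.
have box : compact (`[(-1 : R), 1] `*` `[(-1 : R), 1]).
  by apply: compact_setX; exact: segment_compact.
apply: (subclosed_compact _ box).
- rewrite (_ : S = (fun p => p.1 ^+ 2 + p.2 ^+ 2) @^-1` [set x | x <= 1]) //.
  apply: preimage_closed; last exact: closed_le.
  move=> p _; apply: cvgD.
    by apply: (@cvg_comp _ _ _ fst (fun t : R => t ^+ 2));
      [exact: cvg_fst|exact: exprn_continuous].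
  by apply: (@cvg_comp _ _ _ snd (fun t : R => t ^+ 2));
    [exact: cvg_snd|exact: exprn_continuous].
- move=> [a b] /= ab; rewrite /S /= in ab.
  split; rewrite /= in_itv /=; nra.
Qed.
End ComplexDisc.

(** * Determinants of 3 by 3 matrices and surjectivity of [pi3] *)

Lemma det_mx33 (K : comPzRingType) (A : 'M[K]_3) :
  \det A = A 0 0 * A 1 1 * A 2 2 + A 0 1 * A 1 2 * A 2 0
    + A 0 2 * A 1 0 * A 2 1 - A 0 0 * A 1 2 * A 2 1
    - A 0 1 * A 1 0 * A 2 2 - A 0 2 * A 1 1 * A 2 0.
Proof.
(* Indexing by [nat] lets the lifted ordinals of the cofactor expansion compute, so that [ring]
   recognises equal entries. *)
pose a (i j : nat) := A (inord i) (inord j).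
have aE i j : A i j = a i j by rewrite /a !inord_val.
rewrite (expand_det_row A 0) !big_ord_recl big_ord0 /cofactor.
rewrite !(expand_det_row _ 0) !big_ord_recl !big_ord0 /cofactor !det_mx11.
rewrite !mxE !aE /bump /= ?(addn0, addn1, add1n, add0n).
by rewrite !(expr0, expr1, exprS); ring.
Qed.

(** Up to sign, the coefficient of each monomial is the principal minor of [A] on the same indices,
    and these minors are the entries of [pi3 A]. *)
Lemma det_sub_mul_diag (R : realType) (A : 'M[R[i]]_3) (z : 'rV[R[i]]_3) :
  \det (1%:M - A *m diag_mx z) = multiaffine (pi3 A) z.
Proof.
rewrite mul_mx_diag det_mx33 /multiaffine !big_ord_recl big_ord0 !mxE /=.
rewrite det_mx33; ring.
Qed.

(* The two 3-cycle products u w v' and v u' w' have sum d and product p q r, so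
   they are the roots of a quadratic; a nonzero one can be prescribed freely. *)
Lemma exists_offdiag (F : closedFieldType) (p q r d : F) :
  exists u u' v v' w w' : F,
    [/\ u * u' = p, v * v' = q, w * w' = r & u * w * v' + v * u' * w' = d].
Proof.
have [s st] : exists s, s * (d - s) = p * q * r.
  have [s] := @solve_monicpoly F 2 (nth 0 [:: - (p * q * r); d]) isT.
  rewrite !big_ord_recl big_ord0 /= => s2.
  by exists s; rewrite mulrBr -expr2 s2; ring.
have [s0|s0] := eqVneq s 0; last first.
  exists 1, p, (q / s), s, 1, r; split; rewrite ?mul1r ?divfK //.
  by rewrite -[d](subrK s) -[d - s](mulKf s0) st; field.
have {s s0 st} pqr : p * q * r = 0 by rewrite -st s0 mul0r.
(* With [s = 0] the other root is [d]. If it is nonzero, it is prescribed as [v * u' * w'], and the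
   first product is [p * q * r / d = 0]. If it is zero, a vanishing factor among [p], [q], [r] lets
   both entries of its pair be 0, which kills both products. *)
have [d0|d0] := eqVneq d 0; last first.
  exists p, 1, d, (q / d), r, 1; split; try by field.
  have -> : p * r * (q / d) = p * q * r / d by field.
  by rewrite pqr; field.
have : (p == 0) || (q == 0) || (r == 0) by rewrite -!mulf_eq0 pqr.
rewrite d0 -orbA => /or3P[] /eqP ->.
- by exists 0, 0, 1, q, 1, r; split; ring.
- by exists 1, p, 0, 0, 1, r; split; ring.
- by exists 1, p, 1, q, 0, 0; split; ring.
Qed.

(** The diagonal is read off from [x], the 2 by 2 minors fix the products of opposite off-diagonal
    entries, and the determinant then fixes only the sum of the two 3-cycle products. *)
Lemma pi3_surj (R : realType) (x : 'rV[R[i]]_7) : exists A, pi3 A = x.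
Proof.
pose y (k : nat) := x 0 (inord k).
have yE k : x 0 k = y k by rewrite /y inord_val.
pose p := y 0 * y 1 - y 2; pose q := y 0 * y 3 - y 4.
pose r := y 1 * y 3 - y 5.
have [u [u' [v [v' [w [w' [Ep Eq Er Ed]]]]]]] := exists_offdiag p q r
  (y 6 - y 0 * y 1 * y 3 + y 0 * r + p * y 3 + q * y 1).
exists (\matrix_(i < 3, j < 3) nth 0 (nth [::]
  [:: [:: y 0; u; v]; [:: u'; y 1; w]; [:: v'; w'; y 3]] i) j).
have {}Ed : y 6 = u * w * v' + v * u' * w' -
  (- y 0 * y 1 * y 3 + y 0 * r + p * y 3 + q * y 1) by rewrite Ed; ring.
apply/rowP => k; rewrite mxE yE.
case: k => -[|[|[|[|[|[|[|//]]]]]]] k7 /=; rewrite ?det_mx33 !mxE //=.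
- by rewrite Ep /p; ring.
- by rewrite Eq /q; ring.
- by rewrite Er /r; ring.
- by rewrite Ed -Ep -Eq -Er; ring.
Qed.

(** * The operator norm of a diagonal matrix is the largest modulus of its entries *)

Section DiagonalOperatorNorm.
Context {R : realType} {n : nat}.
Implicit Types z : 'rV[R[i]]_n.

Lemma normc_ge0 (a : R[i]) : 0 <= Normc.normc a.
Proof. by case: a => a b; exact: sqrtr_ge0. Qed.

Lemma enorm_diag_mx_le z (M : R) (v : 'cV[R[i]]_n) :
  (forall i, Normc.normc (z 0 i) <= M) -> 0 <= M -> enorm v <= 1 ->
  enorm (diag_mx z *m v) <= M.
Proof.
move=> zM M0 v1; rewrite -[M]mulr1; apply: le_trans (ler_wpM2l M0 v1).
rewrite /enorm -[M in leRHS](ger0_norm M0) -sqrtr_sqr -sqrtrM ?sqr_ge0 //.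
rewrite ler_wsqrtr // mulr_sumr; apply: ler_sum => i _.
rewrite mul_diag_mx mxE Normc.normcM exprMn ler_wpM2r ?sqr_ge0 //.
by rewrite ler_sqr ?nnegrE ?normc_ge0.
Qed.

Lemma opnorm_diag_mx_le z (M : R) :
  (forall i, Normc.normc (z 0 i) <= M) -> 0 <= M -> opnorm (diag_mx z) <= M.
Proof.
move=> zM M0; apply: ge_sup => [|_ [v /= v1 <-]].
  exists (enorm (diag_mx z *m 0)), 0 => //=.
  rewrite /enorm big1 ?sqrtr0 // => i _.
  by rewrite mxE Normc.normc0 expr0n.
exact: enorm_diag_mx_le.
Qed.

Lemma normc_le_opnorm_diag_mx z i : Normc.normc (z 0 i) <= opnorm (diag_mx z).
Proof.
apply: ub_le_sup.
  (* A crude bound showing that the set under [sup] is bounded above; the estimate itself comes from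
     testing on the basis vector [delta_mx i 0]. *)
  exists (\sum_j Normc.normc (z 0 j)) => _ [v /= v1 <-].
  apply: enorm_diag_mx_le => // [j|]; last first.
    by apply: sumr_ge0 => j _; exact: normc_ge0.
  rewrite (bigD1 j) //= lerDl; apply: sumr_ge0 => k _; exact: normc_ge0.
have enorm_delta (a : R[i]) : enorm (a *: delta_mx i 0) = Normc.normc a.
  rewrite /enorm (bigD1 i) //= big1 => [|j ji].
    by rewrite !mxE !eqxx mulr1 addr0 sqrtr_sqr ger0_norm ?normc_ge0.
  by rewrite !mxE (negbTE ji) mulr0 Normc.normc0 expr0n.
exists (delta_mx i 0) => /=.
  by rewrite -[delta_mx i 0]scale1r enorm_delta Normc.normc1.
rewrite -enorm_delta; congr enorm; apply/matrixP => j k.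
by rewrite mul_diag_mx !mxE; case: eqVneq => [->|]; rewrite ?mulr0.
Qed.
End DiagonalOperatorNorm.

(** * Identification of the domain, its connectedness and its linear convexity *)

Section Domain.
Context {R : realType}.
Local Notation C := (R[i] : numFieldType).
Local Notation N := (nonvanishing (@unit_disc R)).
Implicit Types (x : 'rV[C]_7) (z : 'rV[C]_3).

Definition real_scale x (t : R) : 'rV[C]_7 := weighted_scale x t%:C.

Lemma continuous_real_scale x : continuous (real_scale x).
Proof.
move=> t; apply: (@cvg_comp _ _ _ (fun t : R => t%:C : C)).
  exact: continuous_real_complex.
exact: continuous_weighted_scale.
Qed.

Lemma near_real_scale x t :
  N (real_scale x t) -> \forall s \near t, N (real_scale x s).
Proof.
move=> Nxt; apply: continuous_real_scale.
exact: (open_nbhs_nbhs (conj (open_nonvanishing compact_unit_disc) Nxt)).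
Qed.

Lemma normc_real (t : R) : 0 <= t -> Normc.normc t%:C = t.
Proof. by move=> t0; rewrite /= expr0n addr0 sqrtr_sqr ger0_norm. Qed.

(** Dividing [z] by [t] brings it into the closed unit polydisc, where the scaled point does not
    vanish. *)
Lemma multiaffine_neq0_of_scale x (t : R) z : 0 < t -> N (real_scale x t) ->
  (forall i, Normc.normc (z 0 i) <= t) -> multiaffine x z != 0.
Proof.
move=> t0 Nxt zt; have t0C : t%:C != 0 by rewrite fmorph_eq0 gt_eqF.
rewrite -[z](scalerKV t0C) -multiaffine_scale.
apply: Nxt => i; rewrite /unit_disc /= mxE Normc.normcM -fmorphV.
rewrite normc_real; last by rewrite invr_ge0 ltW.
by rewrite mulrC ler_pdivrMr // mul1r.
Qed.

Lemma nonvanishing_real_scale x (t : R) :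
  0 <= t <= 1 -> N x -> N (real_scale x t).
Proof.
move=> /andP[t0 t1] Nx z zD; rewrite multiaffine_scale; apply: Nx => i.
rewrite /unit_disc /= mxE Normc.normcM normc_real //.
by rewrite mulr_ile1 ?normc_ge0 //; exact: zD.
Qed.

(** Openness of the nonvanishing condition lets the radius grow a little beyond [t]. The case
    [t = 0] makes the infimum in [mu_E] positive, and [t = 1] makes it exceed 1. *)
Lemma exists_zero_radius x (t : R) : 0 <= t -> N (real_scale x t) ->
  exists2 r : R, t < r & forall z, multiaffine x z = 0 ->
    exists i, r < Normc.normc (z 0 i).
Proof.
move=> t0 /near_real_scale /nbhs_ballP[e /= e0 eN].
have {}eN : N (real_scale x (t + e / 2)).
  by apply: eN; rewrite /ball /= opprD addrA subrr add0r normrN gtr0_norm; lra.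
exists (t + e / 2); first lra.
move=> z /eqP xz; apply: contrapT => /forallNP zr; move: xz; apply/negP.
apply: multiaffine_neq0_of_scale eN _; first lra.
by move=> i; rewrite leNgt; apply/negP/zr.
Qed.

Lemma mu_E_lt1P (A : 'M[R[i]]_3) : mu_E (E3_3_111 R) A < 1 <-> N (pi3 A).
Proof.
have singP X : singularizers (E3_3_111 R) A X <->
    exists2 z, X = diag_mx z & multiaffine (pi3 A) z = 0.
  rewrite /singularizers /= mem_E3_3_111; split => [[/diag_mxP[z ->]]|[z ->]].
    by rewrite det_sub_mul_diag => ?; exists z.
  by rewrite -det_sub_mul_diag => ?; split=> //; exact: diag_mx_is_diag.
have lb (r : R) :
    (forall z, multiaffine (pi3 A) z = 0 -> exists i, r < Normc.normc (z 0 i)) ->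
    lbound [set opnorm X | X in singularizers (E3_3_111 R) A] r.
  move=> rP _ [X /singP[z -> /rP[i /ltW ri]] <-].
  exact: le_trans ri (normc_le_opnorm_diag_mx _ _).
rewrite /mu_E; split => [|Nx].
  case: pselect => [sing|nsing _ z _]; last first.
    apply/eqP => xz; apply: nsing; exists (diag_mx z); apply/singP.
    by exists z.
  (* Positivity of the infimum matters: as the inverse of 0 is 0, a zero infimum would also give
     [mu_E] below 1. *)
  have [|r r0 /lb rlb] := @exists_zero_radius (pi3 A) 0 (lexx 0).
    by rewrite /real_scale weighted_scale0; exact: nonvanishing0.
  have inf0 : 0 < inf [set opnorm X | X in singularizers (E3_3_111 R) A].
    by apply: lt_le_trans r0 _; apply: lb_le_inf rlb; exact: image_nonempty.
  rewrite invf_lt1 // => inf1 z zD; apply/eqP => xz.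
  suff : inf [set opnorm X | X in singularizers (E3_3_111 R) A] <= 1.
    by rewrite leNgt inf1.
  apply: le_trans (_ : opnorm (diag_mx z) <= 1).
    apply: ge_inf; first by exists r.
    by exists (diag_mx z) => //; apply/singP; exists z.
  exact: opnorm_diag_mx_le.
case: pselect => [sing|nsing] /=; last exact: ltr01.
(* A radius strictly above 1 is required, since zeros outside the closed polydisc alone only bound
   the infimum below by 1. *)
have [|r r1 /lb rlb] := @exists_zero_radius (pi3 A) 1 ler01.
  by rewrite /real_scale weighted_scale1.
have inf1 : 1 < inf [set opnorm X | X in singularizers (E3_3_111 R) A].
  by apply: lt_le_trans r1 _; apply: lb_le_inf rlb; exact: image_nonempty.
by rewrite invf_lt1 // (lt_trans ltr01).
Qed.

Lemma G_E3_3_111E : G_E3_3_111 R = N.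
Proof.
apply/seteqP; split => [_ [A /mu_E_lt1P NA <-] //|x Nx].
by have [A Ax] := pi3_surj x; exists A => //; apply/mu_E_lt1P; rewrite Ax.
Qed.

Lemma domain_nonvanishing : domain N.
Proof.
split; first by exists 0; exact: nonvanishing0.
  exact/open_nonvanishing/compact_unit_disc.
(* The set is a union of weighted paths from the origin to its points, each staying inside it; all
   of them share the origin, hence connectedness. *)
have -> : N = \bigcup_(x in N) (real_scale x @` `[0, 1]).
  apply/seteqP; split => [x Nx|_ [x Nx [t /= t01 <-]]].
    exists x => //; exists 1; first by rewrite /= in_itv /= ler01 lexx.
    by rewrite /real_scale weighted_scale1.
  by apply: nonvanishing_real_scale => //; rewrite in_itv in t01.
apply: bigcup_connected => [|x _].
  exists 0 => x _; exists 0; first by rewrite /= in_itv /= ler01 lexx.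
  by rewrite /real_scale weighted_scale0.
apply: connected_continuous_connected; first exact: segment_connected.
exact/continuous_subspaceT/continuous_real_scale.
Qed.

Lemma linearly_convex_nonvanishing (D : set C) :
  @linearly_convex R 7 (nonvanishing D).
Proof.
(* At [z = 0] the polynomial is constantly 1 and its zero set is empty, not a hyperplane; leaving
   this [z] out loses no point of the complement. *)
exists [set [set x | multiaffine x z = 0] |
    z in [set z : 'rV[C]_3 | polydisc D z /\ z != 0]].
  move=> _ [z [_ z0] <-]; exists (monomials z), (-1); split.
    by apply: contraNneq z0 => /monomials_eq0 ->.
  apply/seteqP; split => x /=; rewrite /multiaffine => /eqP.
    by rewrite addrC addr_eq0 => /eqP.
  by rewrite -addr_eq0 addrC => /eqP.
apply/seteqP; split => [x /existsNP[z /not_implyP[zD /negP/negPn/eqP xz]]|].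
  exists [set x | multiaffine x z = 0] => //; exists z => //; split => //.
  by apply: contra_eq_neq xz => ->; rewrite multiaffine0 oner_neq0.
by move=> x [_ [z [zD _] <-]] /= xz /(_ z zD); rewrite xz eqxx.
Qed.
End Domain.

Theorem proposition3p10 (R : realType) :
  domain (G_E3_3_111 R) /\ linearly_convex (G_E3_3_111 R).
Proof.
rewrite G_E3_3_111E; split; first exact: domain_nonvanishing.
exact: linearly_convex_nonvanishing.
Qed.
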